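(* Let $\alpha\in\mathbb{F}_q((z^{-1}))$ be irrational and let $Q_k$ be the denominator of its $k$-th convergent. If $\liminf_{k\to\infty}\frac{\log\|Q_k\|}{k}<\infty$, then $\dim_H\mathrm{Bad}^{\varepsilon}(\alpha)<1$ for every $\varepsilon>0$.
   Context: Let $q$ be a prime power, $\mathbb{F}_q[z]$ the polynomial ring over $\mathbb{F}_q$, $\mathbb{F}_q((z^{-1}))$ the field of formal Laurent series in $z^{-1}$, with $\|x\|=q^{\deg x}$ for $x\ne0$, $\|0\|=0$; irrational means not in $\mathbb{F}_q(z)$. $|\langle x\rangle|=\min_{y\in\mathbb{F}_q[z]}\|x-y\|$, $\mathbb{I}=\{x:\|x\|<1\}$. For $\varepsilon>0$, $\mathrm{Bad}^{\varepsilon}(\alpha)=\{\theta\in\mathbb{I}:\liminf_{Q\in\mathbb{F}_q[z],\|Q\|\to\infty}\|Q\|\,|\langle Q\alpha-\theta\rangle|\ge\varepsilon\}$; $\dim_H$ is Hausdorff dimension with respect to the metric $\|x-y\|$. Continued fraction: $\alpha=A_0+1/(A_1+1/(A_2+\cdots))$, $A_i\in\mathbb{F}_q[z]$, $\deg A_i\ge1$ for $i\ge1$ (polynomial parts of the iterates of $x\mapsto1/x-[1/x]$); $Q_{-1}=0$, $Q_0=1$, $Q_{k+1}=A_{k+1}Q_k+Q_{k-1}$. *)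

(* Defs.v *)
From HB Require Import structures.
From mathcomp Require Import all_boot all_order all_algebra.
From mathcomp Require Import all_classical all_reals all_analysis.
From mathcomp Require Import zify.

Set Implicit Arguments.
Unset Strict Implicit.
Unset Printing Implicit Defensive.

Import Order.TTheory GRing.Theory Num.Theory.

Local Open Scope classical_set_scope.
Local Open Scope ring_scope.

(* A Laurent series in z^-1 is its family of coefficients f : int -> F, with
   f n the coefficient of z^n, vanishing for all large enough n. *)
Definition ubounded (F : fieldType) : {pred int -> F} :=
  fun f => `[< exists N : int, forall n : int, N < n -> f n = 0 >].

Lemma uboundedP (F : fieldType) (f : int -> F) :
  reflect (exists N : int, forall n : int, N < n -> f n = 0)
          (f \in @ubounded F).
Proof. by rewrite unfold_in; exact: asboolP. Qed.

Lemma ubounded_zmod_closed (F : fieldType) : zmod_closed (@ubounded F).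
Proof.
split; first by apply/uboundedP; exists 0.
move=> f g /uboundedP[N fN] /uboundedP[M gM].
apply/uboundedP; exists (Num.max N M) => n; rewrite gt_max => /andP[Nn Mn].
have -> : (f - g) n = f n - g n by [].
by rewrite fN// gM// subr0.
Qed.
HB.instance Definition _ (F : fieldType) :=
  GRing.isZmodClosed.Build (int -> F) (@ubounded F) (@ubounded_zmod_closed F).

Record laurent (F : fieldType) := Laurent {
  lcoef :> int -> F;
  _ : lcoef \in @ubounded F
}.

HB.instance Definition _ (F : fieldType) := [isSub for @lcoef F].
HB.instance Definition _ (F : fieldType) := [Choice of laurent F by <:].
HB.instance Definition _ (F : fieldType) :=
  [SubChoice_isSubZmodule of laurent F by <:].

(* Finitely supported sum: all but finitely many terms vanish. *)
Definition lconv (F : fieldType) (f g : int -> F) : int -> F :=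
  fun n => \sum_(i \in [set: int]) (f i * g (n - i)).

Section LaurentField.
Context {F : fieldType}.
Implicit Types (f g : int -> F) (a b c : nat -> F) (x y : laurent F).

Definition psmul a b (k : nat) : F := \sum_(i < k.+1) a i * b (k - i)%N.

Lemma eq_psmul a a' b b' k :
  (forall i, (i <= k)%N -> a i = a' i) -> (forall i, (i <= k)%N -> b i = b' i) ->
  psmul a b k = psmul a' b' k.
Proof.
move=> aa bb; apply: eq_bigr => i _.
by rewrite aa ?bb ?leq_subr// -ltnS.
Qed.

Lemma psmul_coef a b n k : (k < n)%N ->
  psmul a b k = ((\poly_(i < n) a i) * (\poly_(i < n) b i))`_k.
Proof.
move=> kn; rewrite coefM; apply: eq_bigr => i _; rewrite !coef_poly.
by rewrite !(leq_ltn_trans _ kn) ?leq_subr// -ltnS.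
Qed.

Lemma psmulC a b k : psmul a b k = psmul b a k.
Proof. by rewrite !(psmul_coef _ _ (ltnSn k)) mulrC. Qed.

Lemma psmulA a b c k : psmul a (psmul b c) k = psmul (psmul a b) c k.
Proof.
pose p (d : nat -> F) := \poly_(i < k.+1) d i.
have pE d i : (i <= k)%N -> (p d)`_i = d i by move=> ik; rewrite coef_poly ltnS ik.
have pME d e i : (i <= k)%N -> (p d * p e)`_i = psmul d e i.
  by move=> ik; rewrite (@psmul_coef _ _ k.+1).
transitivity (p a * (p b * p c))`_k.
  rewrite coefM; apply: eq_bigr => i _.
  by rewrite pE ?pME ?leq_subr// -ltnS.
rewrite mulrA coefM; apply: eq_bigr => i _.
by rewrite pME ?pE ?leq_subr// -ltnS.
Qed.

Definition coef_below f (N : int) : nat -> F := fun k => f (N - k%:Z).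

Definition bnd f (N : int) := forall n : int, N < n -> f n = 0.

Lemma lconvE f g N M k : bnd f N -> bnd g M ->
  lconv f g (N + M - k%:Z) = psmul (coef_below f N) (coef_below g M) k.
Proof.
move=> fN gM; rewrite /lconv.
have ue : uniq [seq N - (i : nat)%:Z | i <- iota 0 k.+1].
  by rewrite map_inj_uniq ?iota_uniq// => i j ij; lia.
rewrite (fsbigE _ _ ue)//; last first.
  move=> i _ /mapP nin; have [Ni|iN] := ltP N i; first by rewrite fN ?mul0r.
  rewrite gM ?mulr0//; rewrite ltNge; apply/negP => h; apply: nin.
  exists `|N - i|%N; last by lia.
  by rewrite mem_iota; lia.
rewrite big_map.
under eq_bigl do rewrite mem_setT.
rewrite -[iota 0 k.+1]/(index_iota 0 k.+1) big_mkord.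
apply: eq_bigr => i _; rewrite /coef_below; congr (_ * g _).
by have := ltn_ord i; lia.
Qed.

Lemma lconv_bnd f g N M : bnd f N -> bnd g M -> bnd (lconv f g) (N + M).
Proof.
move=> fN gM n nNM; rewrite /lconv fsbig1// => i _.
have [Ni|iN] := ltP N i; first by rewrite fN ?mul0r.
by rewrite gM ?mulr0//; lia.
Qed.

Lemma bndP x : exists N, bnd x N.
Proof. by case: x => f /= /uboundedP[N fN]; exists N. Qed.

Lemma laurentP x y : (forall n, x n = y n) -> x = y.
Proof. by move=> xy; apply/val_inj/funext. Qed.

Lemma ltNE (N n : int) : n <= N -> n = N - `|N - n|%N%:Z.
Proof. by lia. Qed.

Fact lconv_ubounded x y : lconv x y \in @ubounded F.
Proof.
have [N xN] := bndP x; have [M yM] := bndP y.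
by apply/uboundedP; exists (N + M); exact: lconv_bnd.
Qed.
Definition lmul x y : laurent F := Laurent (lconv_ubounded x y).

Fact lone_ubounded : (fun n : int => (n == 0)%:R : F) \in @ubounded F.
Proof. by apply/uboundedP; exists 0 => n; rewrite lt0r => /andP[/negPf->]. Qed.
Definition lone : laurent F := Laurent lone_ubounded.

Fact lmulC : commutative lmul.
Proof.
move=> x y; apply: laurentP => n /=.
have [N xN] := bndP x; have [M yM] := bndP y.
have [h|h] := ltP (N + M) n.
  by rewrite (lconv_bnd xN yM)// (lconv_bnd yM xN)// addrC.
by rewrite (ltNE h) lconvE// [N + M]addrC lconvE// psmulC.
Qed.

Fact lmulA : associative lmul.
Proof.
move=> x y z; apply: laurentP => n /=.
have [N xN] := bndP x; have [M yM] := bndP y; have [P zP] := bndP z.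
have xyb := lconv_bnd xN yM; have yzb := lconv_bnd yM zP.
have [h|h] := ltP (N + (M + P)) n.
  by rewrite (lconv_bnd xN yzb)// (lconv_bnd xyb zP)// -addrA.
rewrite (ltNE h) lconvE// [N + (M + P)]addrA lconvE//.
rewrite (@eq_psmul _ (coef_below x N) _ (psmul (coef_below y M) (coef_below z P)))//;
  last by move=> i _; rewrite [LHS]lconvE.
rewrite psmulA; apply: eq_psmul => // i _.
by rewrite [RHS]lconvE.
Qed.

Fact lmul1 : left_id lone lmul.
Proof.
move=> x; apply: laurentP => n; rewrite /= /lconv.
rewrite (fsbigE [:: 0])//; last first.
  by move=> i _; rewrite inE /= => /negPf ->; rewrite mul0r.
by rewrite big_cons big_nil mem_setT; rewrite subr0 eqxx mul1r /= addr0.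
Qed.

Fact lmulDl : left_distributive lmul +%R.
Proof.
move=> x y z; apply: laurentP => n.
have [N xN] := bndP x; have [M yM] := bndP y; have [P zP] := bndP z.
pose K := Num.max N M.
have xK : bnd x K by move=> i; rewrite gt_max => /andP[? _]; exact: xN.
have yK : bnd y K by move=> i; rewrite gt_max => /andP[_ ?]; exact: yM.
have xyE i : (x + y) i = x i + y i by [].
have xyK : bnd (x + y) K by move=> i Ki; rewrite xyE xK// yK// addr0.
have -> : (lmul x z + lmul y z) n = lconv x z n + lconv y z n by [].
rewrite /=; have [h|h] := ltP (K + P) n.
  by rewrite (lconv_bnd xyK zP)// (lconv_bnd xK zP)// (lconv_bnd yK zP)// addr0.
rewrite (ltNE h) !lconvE// /psmul -big_split/=; apply: eq_bigr => i _.
by rewrite -mulrDl.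
Qed.

Fact lone_neq0 : lone != 0.
Proof.
apply/eqP => /(congr1 (fun x : laurent F => x 0)) /=.
by move/eqP; rewrite oner_eq0.
Qed.

HB.instance Definition _ := GRing.Zmodule_isComNzRing.Build (laurent F)
  lmulA lmulC lmul1 lmulDl lone_neq0.

Fixpoint psinv_upto a (n : nat) : nat -> F :=
  if n isn't m.+1 then fun=> 0 else
  fun k => if (k < m)%N then psinv_upto a m k else
    ((m == 0%N)%:R - \sum_(i < m) psinv_upto a m i * a (m - i)%N) / a 0%N.

Lemma psinv_ex a : a 0%N != 0 -> exists b, forall k, psmul b a k = (k == 0%N)%:R.
Proof.
move=> a0; exists (fun k => psinv_upto a k.+1 k) => k.
have stable n i : (i < n)%N -> psinv_upto a n i = psinv_upto a i.+1 i.
  elim: n => // n IH; rewrite ltnS leq_eqVlt => /predU1P[->//|lin].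
  by rewrite -IH//= lin.
rewrite /psmul big_ord_recr subnn /= ltnn mulfVK//.
under eq_bigr => i _ do rewrite -[if _ then _ else _]/(psinv_upto a i.+1 i)
  -(stable k)//.
by rewrite addrC subrK.
Qed.

Lemma deg_ex x : x != 0 -> exists d : int, x d != 0 /\ bnd x d.
Proof.
move=> x0; have [N xN] := bndP x.
have [n xn] : exists n, x n != 0.
  apply: contrapT => h; move/eqP: x0; apply; apply: laurentP => n.
  by apply/eqP; apply: contrapT => xn; apply: h; exists n; apply/negP.
have nN : n <= N by rewrite leNgt; apply/negP => /xN /eqP; exact/negP.
have [|k xk kmin] := @ex_minnP (fun k => x (N - k%:Z) != 0).
  by exists `|N - n|%N; rewrite -ltNE.
exists (N - k%:Z); split=> // m km; have [Nm|mN] := ltP N m; first exact: xN.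
apply/eqP; apply: contraPT isT => xm; have := kmin `|N - m|%N.
by rewrite -ltNE// => /(_ xm); lia.
Qed.

Lemma linv_ex x : x != 0 -> exists y, y * x = 1.
Proof.
move=> /deg_ex[d [xd xb]].
have [|b bE] := @psinv_ex (coef_below x d); first by rewrite /coef_below subr0.
pose f (n : int) : F := if n <= - d then b `|(- d - n)%R|%N else 0.
have fb : bnd f (- d) by move=> n; rewrite /f leNgt => ->.
have fu : f \in @ubounded F by apply/uboundedP; exists (- d).
exists (Laurent fu); apply: laurentP => n; rewrite -[LHS]/(lconv f x n).
rewrite -[RHS]/((n == 0)%:R : F).
have [h|h] := ltP (- d + d) n.
  by rewrite (lconv_bnd fb xb)//; rewrite addNr in h; rewrite gt_eqF.
have [k ->] : exists k : nat, n = - d + d - k%:Z by eexists; exact: ltNE.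
rewrite lconvE//.
have -> : psmul (coef_below f (- d)) (coef_below x d) k =
    psmul b (coef_below x d) k.
  apply: eq_psmul => // i _; rewrite /coef_below /f ifT; last by lia.
  by congr b; lia.
by rewrite bE; congr (_%:R); congr nat_of_bool; apply/eqP/eqP; lia.
Qed.

Definition linv x : laurent F := xget 0 [set y | y * x = 1].

Fact mulVl x : x != 0 -> linv x * x = 1.
Proof. by move=> /linv_ex; exact: xgetPex. Qed.

Fact linv0 : linv 0 = 0.
Proof. by apply: xgetPN => y /=; rewrite mulr0 => /esym/eqP; rewrite oner_eq0. Qed.

HB.instance Definition _ :=
  GRing.ComNzRing_isField.Build (laurent F) mulVl linv0.

Fact of_poly_ubounded (p : {poly F}) :
  (fun n : int => if n is Posz k then p`_k else 0) \in @ubounded F.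
Proof.
apply/uboundedP; exists (size p)%:Z => -[] // n; rewrite ltz_nat => sn.
by rewrite nth_default// ltnW.
Qed.
Definition of_poly (p : {poly F}) : laurent F := Laurent (of_poly_ubounded p).

(* For x != 0 this set is a singleton; ldeg 0 = 0 is a dummy value. *)
Definition ldeg x : int :=
  xget 0 [set d : int | x d != 0 /\ forall n : int, d < n -> x n = 0].

Lemma ldegP x : x != 0 -> x (ldeg x) != 0 /\ bnd x (ldeg x).
Proof. by move=> /deg_ex; exact: xgetPex. Qed.

Lemma ldeg_ge x n : x n != 0 -> n <= ldeg x.
Proof.
move=> xn; rewrite leNgt; apply/negP => h; move/negP: xn; apply; apply/eqP.
have [->//|/ldegP[_]] := eqVneq x 0; exact.
Qed.

(* The coefficients of index above `|ldeg x| all vanish, so this keeps every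
   coefficient of nonnegative index; it is 0 if ldeg x < 0. *)
Definition poly_part x : {poly F} := \poly_(i < `|ldeg x|.+1) x i%:Z.

Lemma coef_poly_part x (i : nat) : (poly_part x)`_i = x i%:Z.
Proof.
rewrite coef_poly; case: ltnP => // h; apply/esym/eqP/negPn/negP => /ldeg_ge.
by lia.
Qed.

Definition lirrational x :=
  forall p q : {poly F}, q != 0 -> x <> of_poly p / of_poly q.

(* cf_tail x k is the fractional part x_k, with x_0 = x - [x] and
   x_(k+1) = 1/x_k - [1/x_k]. *)
Fixpoint cf_tail x (k : nat) : laurent F :=
  if k is j.+1 then (cf_tail x j)^-1 - of_poly (poly_part (cf_tail x j)^-1)
  else x - of_poly (poly_part x).

Definition cf_quot x (k : nat) : {poly F} :=
  if k is j.+1 then poly_part (cf_tail x j)^-1 else poly_part x.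

(* The pair (Q_(k-1), Q_k). *)
Fixpoint cf_den2 x (k : nat) : {poly F} * {poly F} :=
  if k is j.+1 then
    let: (Q', Q) := cf_den2 x j in (Q, cf_quot x j.+1 * Q + Q')
  else (0, 1).

Definition cf_den x (k : nat) : {poly F} := (cf_den2 x k).2.

End LaurentField.

Section Norm.
Context (R : realType) {F : finFieldType}.
Implicit Types (x y : laurent F).

Definition lnorm x : R := if x == 0 then 0 else #|F|%:R ^ ldeg x.

Definition ldist x y : R := lnorm (x - y).

Definition dist_poly x : R := inf [set ldist x (of_poly p) | p in [set: {poly F}]].

Lemma lnorm_ge0 x : 0 <= lnorm x.
Proof. by rewrite /lnorm; case: ifP => // _; apply: exprz_ge0. Qed.

Lemma poly_part_nearest x p :
  ldist x (of_poly (poly_part x)) <= ldist x (of_poly p).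
Proof.
rewrite /ldist; set y := x - _; set z := x - of_poly p.
have [y0|/[dup] y0 /ldegP[yd _]] := eqVneq y 0.
  by rewrite {1}/lnorm y0 eqxx lnorm_ge0.
have zd : z (ldeg y) != 0.
  have yE n : y n = x n - of_poly (poly_part x) n by [].
  have zE n : z n = x n - of_poly p n by [].
  move: yd; rewrite yE zE; case: (ldeg y) => n //=.
  by rewrite coef_poly_part subrr eqxx.
have z0 : z != 0 by apply: contra_neq zd => ->.
rewrite /lnorm (negPf y0) (negPf z0) ler_weXz2l ?ldeg_ge// ler1n.
exact/card_gt0P/(ex_intro _ 0).
Qed.

(* The infimum in dist_poly is a minimum. *)
Lemma dist_polyE x : dist_poly x = ldist x (of_poly (poly_part x)).
Proof.
apply/eqP; rewrite eq_le; apply/andP; split.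
  apply: ge_inf; last by exists (poly_part x).
  by exists 0 => _ [p _ <-]; exact: lnorm_ge0.
apply: lb_le_inf; first by exists (ldist x (of_poly (poly_part x))), (poly_part x).
by move=> _ [p _ <-]; exact: poly_part_nearest.
Qed.

Definition unit_ball : set (laurent F) := [set x | lnorm x < 1].

(* liminf of f Q as the norm of the polynomial Q tends to infinity. *)
Definition poly_liminf (f : {poly F} -> \bar R) : \bar R :=
  ereal_sup [set ereal_inf [set f Q | Q in [set Q | M <= lnorm (of_poly Q)]]
            | M in [set: R]].

Definition Bad (eps : R) (alpha : laurent F) : set (laurent F) :=
  [set theta | unit_ball theta /\
    (eps%:E <= poly_liminf (fun Q =>
       (lnorm (of_poly Q) * dist_poly (of_poly Q * alpha - theta))%:E))%E].

End Norm.

Section Hausdorff.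
Context {R : realType} {T : Type} (d : T -> T -> R).
Local Open Scope ereal_scope.

Definition diam (A : set T) : \bar R :=
  ereal_sup [set (d x y)%:E | x in A & y in A].

(* The empty set contributes 0 for every s, including s = 0. *)
Definition diam_pow (s : R) (A : set T) : \bar R :=
  if `[< A = set0 >] then 0 else poweR (diam A) s.

Definition hausdorff_premeasure (s delta : R) (A : set T) : \bar R :=
  ereal_inf [set \sum_(0 <= i <oo) diam_pow s (U i) | U in
    [set U : (set T)^nat | A `<=` \bigcup_i U i /\ forall i, diam (U i) <= delta%:E]].

Definition hausdorff_measure (s : R) (A : set T) : \bar R :=
  ereal_sup [set hausdorff_premeasure s delta A | delta in [set e : R | (0 < e)%R]].

Definition hausdorff_dim (A : set T) : \bar R :=
  ereal_inf [set s%:E | s in [set s : R | (0 <= s)%R /\ hausdorff_measure s A = 0]].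

End Hausdorff.

(* Main.v *)
Require Import Defs.
From mathcomp Require Import all_boot all_order all_algebra.
From mathcomp Require Import all_classical all_reals all_analysis.
From mathcomp Require Import zify ring lra.
Import Order.TTheory GRing.Theory Num.Theory.
Local Open Scope classical_set_scope.
Local Open Scope ring_scope.
Set Implicit Arguments.
Unset Strict Implicit.

(* Write d_k = deg Q_k. Around every theta there is, for every k, a polynomial Q of
   degree exactly d_k with |<Q alpha - theta>| < q^-d_k. Hence every ball of radius
   q^-d_k contains a ball of radius q^-(d_k + c), q^-c < eps, which misses all the
   points that are eps-badly approximable from the norm q^d_k on. Passing from the
   scale d_k to d_(k+c) >= d_k + c therefore costs a factor 1 - q^-c in the number of
   balls needed, so at scale q^-d_k about (1 - q^-c)^(k/c) q^d_k balls suffice. When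
   d_k <= C k for infinitely many k, this is at most q^(d_k (1 - eta)) with eta > 0. *)

(** * Continued fractions of Laurent series *)

Section Laurent.
Context {F : fieldType}.
Implicit Types (x y alpha theta : laurent F) (p q : {poly F}).

Lemma bndD x y (N : int) : bnd x N -> bnd y N -> bnd (x + y) N.
Proof.
move=> xN yN n Nn; have -> : (x + y) n = x n + y n by [].
by rewrite xN// yN// addr0.
Qed.

Lemma bndN x (N : int) : bnd x N -> bnd (- x) N.
Proof.
by move=> xN n Nn; have -> : (- x) n = - x n by []; rewrite xN// oppr0.
Qed.

Lemma bndB x y (N : int) : bnd x N -> bnd y N -> bnd (x - y) N.
Proof. by move=> xN yN; apply: bndD => //; exact: bndN. Qed.

Lemma bndM x y (N M : int) : bnd x N -> bnd y M -> bnd (x * y) (N + M).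
Proof. exact: lconv_bnd. Qed.

Lemma bndW x (N M : int) : bnd x N -> N <= M -> bnd x M.
Proof. by move=> xN NM n Mn; apply: xN; exact: le_lt_trans Mn. Qed.

Lemma ldeg_bnd x : bnd x (ldeg x).
Proof.
by have [->//|/ldegP[]] := eqVneq x 0.
Qed.

Lemma ldeg_eq x (d : int) : x d != 0 -> bnd x d -> ldeg x = d.
Proof.
move=> xd xb; apply/eqP; rewrite eq_le ldeg_ge// andbT leNgt; apply/negP.
move=> /xb /eqP; apply/negP; apply: (ldegP _).1.
by apply: contraNneq xd => ->.
Qed.

Lemma ldegM x y : x != 0 -> y != 0 -> ldeg (x * y) = ldeg x + ldeg y.
Proof.
move=> /ldegP[xd xb] /ldegP[yd yb]; apply: ldeg_eq; last exact: bndM.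
have -> : (x * y) (ldeg x + ldeg y) = lconv x y (ldeg x + ldeg y - 0%:Z).
  by rewrite subr0.
by rewrite lconvE// /psmul big_ord_recl big_ord0 addr0 /coef_below !subr0 mulf_neq0.
Qed.

Lemma ldegN x : ldeg (- x) = ldeg x.
Proof.
have [->|x0] := eqVneq x 0; first by rewrite oppr0.
apply: ldeg_eq; last exact/bndN/(@ldeg_bnd x).
have -> : (- x) (ldeg x) = - x (ldeg x) by [].
by rewrite oppr_eq0; case: (ldegP x0).
Qed.

Lemma ldeg1 : ldeg (1 : laurent F) = 0.
Proof.
apply: ldeg_eq; first exact: (@oner_neq0 F).
by move=> n n0; have -> : (1 : laurent F) n = (n == 0)%:R by []; rewrite gt_eqF.
Qed.

Lemma ldegV x : x != 0 -> ldeg x^-1 = - ldeg x.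
Proof.
move=> x0; have := ldegM x0 (_ : x^-1 != 0); rewrite invr_eq0 => /(_ x0).
by rewrite divff// ldeg1; lia.
Qed.

(** * Polynomials inside the field of Laurent series *)

Lemma coef_of_poly p (n : nat) : of_poly p n = p`_n.
Proof. by []. Qed.

Lemma of_polyD p q : of_poly (p + q) = of_poly p + of_poly q.
Proof.
apply: laurentP => -[] n; last exact/esym/addr0.
by rewrite [LHS]coefD.
Qed.

Lemma of_poly0 : of_poly (0 : {poly F}) = 0.
Proof. by apply: laurentP => -[] n //=; rewrite coef0. Qed.

Lemma of_poly1 : of_poly (1 : {poly F}) = 1.
Proof. by apply: laurentP => -[] n //=; rewrite coef1. Qed.

Lemma of_polyN p : of_poly (- p) = - of_poly p.
Proof.
by apply/eqP; rewrite eq_sym eqr_oppLR -addr_eq0 -of_polyD addrC addNr of_poly0.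
Qed.

(** The convolution runs over all integers, but a term survives only if i and n - i are both
    nonnegative, which leaves the polynomial product. *)
Lemma of_polyM p q : of_poly (p * q) = of_poly p * of_poly q.
Proof.
apply: laurentP => n;
have -> : (of_poly p * of_poly q) n = lconv (of_poly p) (of_poly q) n by [].
rewrite /lconv; case: n => n; last first.
  rewrite fsbig1//= => -[i|i] _; last by rewrite mul0r.
  by rewrite [X in _ * X](_ : _ = 0) ?mulr0//; case E : (_ - _) => //; lia.
have ue : uniq [seq (i : nat)%:Z | i <- iota 0 n.+1].
  by rewrite map_inj_uniq ?iota_uniq// => i j [].
rewrite (fsbigE _ _ ue)//; last first.
  move=> -[i|i] _ /mapP nin; last by rewrite mul0r.
  have ni : (n < i)%N.
    rewrite ltnNge; apply/negP => h; apply: nin; exists i => //.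
    by rewrite mem_iota.
  by rewrite [X in _ * X](_ : _ = 0) ?mulr0//=; case E : (_ - _) => //; lia.
rewrite big_map.
under eq_bigl do rewrite mem_setT.
rewrite -[iota 0 n.+1]/(index_iota 0 n.+1) big_mkord [LHS]coefM.
apply: eq_bigr => i _; congr (_ * _).
by rewrite -coef_of_poly -subzn// -ltnS.
Qed.

Lemma of_poly_bnd p (n : nat) : (size p <= n)%N -> bnd (of_poly p) (n%:Z - 1).
Proof.
by move=> pn -[k|k]// h; rewrite coef_of_poly nth_default// (leq_trans pn)//; lia.
Qed.

Lemma ldeg_of_poly p : p != 0 -> ldeg (of_poly p) = (size p).-1.
Proof.
move=> p0; apply: ldeg_eq; first by rewrite coef_of_poly -lead_coefE lead_coef_eq0.
move: p0; rewrite -size_poly_gt0 => p0.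
by apply: (bndW (of_poly_bnd (leqnn _))); lia.
Qed.

Lemma of_poly_eq0 p : (of_poly p == 0) = (p == 0).
Proof.
apply/eqP/eqP => [h|->]; last exact: of_poly0.
by apply/polyP => n; rewrite -coef_of_poly h coef0.
Qed.

Lemma size_poly_part x (n : nat) : bnd x (n%:Z - 1) -> (size (poly_part x) <= n)%N.
Proof. by move=> xb; apply/leq_sizeP => j nj; rewrite coef_poly_part xb//; lia. Qed.

Lemma size_poly_part_ldeg x (n : nat) : x != 0 -> ldeg x = n ->
  size (poly_part x) = n.+1.
Proof.
move=> /ldegP[xd _] xn; apply/eqP; rewrite eqn_leq size_poly_part/=; last first.
  by apply: (bndW (@ldeg_bnd x)); rewrite xn; lia.
rewrite ltnNge; apply/negP => h; move/eqP: xd; apply.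
by rewrite xn -coef_poly_part nth_default.
Qed.

Lemma frac_bnd x : bnd (x - of_poly (poly_part x)) (-1).
Proof.
move=> -[n|n] // h.
have -> : (x - of_poly (poly_part x)) n = x n - of_poly (poly_part x) n by [].
by rewrite /= coef_poly_part subrr.
Qed.

(** Put D_k = Q_k alpha - P_k and let x_k be the k-th tail. The recurrence for Q_k and x_k^-1 =
    A_{k+1} + x_{k+1} propagate D_k = -x_k D_{k-1}, and the degrees add up to deg D_{k-1} = -deg
    Q_k. *)
Lemma cf_invariant alpha k : lirrational alpha ->
  let: (Q', Q) := cf_den2 alpha k in
  exists P' P, let D' := of_poly Q' * alpha - of_poly P' in
  [/\ (size Q' < size Q)%N, D' != 0, ldeg D' = - (size Q).-1%:Z,
      of_poly Q * alpha - of_poly P = - cf_tail alpha k * D'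
    & bnd (cf_tail alpha k) (-1)].
Proof.
move=> irr; elim: k => [|k] /=.
  (* P_{-1} = 1 and P_0 = [alpha], so D_{-1} = -1 has degree 0 = -deg Q_0. *)
  exists 1, (poly_part alpha).
  rewrite size_poly0 size_poly1 of_poly0 of_poly1 mul0r mul1r sub0r oppr_eq0 oner_eq0.
  by rewrite ldegN ldeg1 mulrN mulr1 opprK; split=> //; exact: frac_bnd.
case: (cf_den2 alpha k) => Q' Q [P' [P]] [sQ D'0 dD' DE xb].
set D' := of_poly Q' * _ - _ in D'0 dD' DE.
set x := cf_tail alpha k in DE xb *; set D := of_poly Q * _ - _ in DE.
set A := poly_part x^-1.
have Q0 : Q != 0 by rewrite -size_poly_gt0; exact: leq_ltn_trans sQ.
have D0 : D != 0.
  rewrite subr_eq0; apply/eqP => h; apply: (irr P Q Q0); rewrite -h mulrAC.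
  by rewrite divff ?mul1r// of_poly_eq0.
(* Irrationality keeps every tail nonzero, so [x^-1] is never the default inverse of 0. *)
have x0 : x != 0 by apply: contraNneq D0 => x0; rewrite DE x0 oppr0 mul0r.
have dx : ldeg x <= -1.
  by rewrite leNgt; apply/negP => /xb /eqP; apply/negP; case: (ldegP x0).
have [a xa] : exists a : nat, ldeg x = - a.+1%:Z by exists `|ldeg x|.-1; lia.
have sA : size A = a.+2.
  by apply: size_poly_part_ldeg; rewrite ?invr_eq0// ldegV// xa opprK.
have A0 : A != 0 by rewrite -size_poly_gt0 sA.
have sAQ : size (A * Q) = (a.+1 + size Q)%N by rewrite size_mul// sA.
have sQQ : size (A * Q + Q') = (a.+1 + size Q)%N.
  by rewrite size_polyDl sAQ// (leq_trans sQ)// leq_addl.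
exists P, (A * P + P'); rewrite -/D; split.
- by rewrite sQQ addSn ltnS leq_addl.
- by [].
- rewrite sQQ DE ldegM ?oppr_eq0// ldegN xa dD'.
  by rewrite -[in RHS](@prednK (size Q)) ?size_poly_gt0// addnS PoszD opprD.
- rewrite !of_polyD !of_polyM.
  transitivity (of_poly A * D + D'); first by rewrite /D /D'; ring.
  (* Inverting D_k = -x_k D_{k-1} turns the sum into -(x_k^-1 - A) D_k, and x_k^-1 - A is the next
     tail. *)
  have -> : D' = - (x^-1 * D) by rewrite DE mulNr mulrN opprK mulKf.
  ring.
- exact: frac_bnd.
Qed.

Lemma cf_den_neq0 alpha k : lirrational alpha -> cf_den alpha k != 0.
Proof.
move=> /(@cf_invariant alpha k); rewrite /cf_den.
case: cf_den2 => Q' Q [P' [P [sQ _ _ _ _]]] /=.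
by rewrite -size_poly_gt0; exact: leq_ltn_trans sQ.
Qed.

Definition cf_deg alpha k : nat := (size (cf_den alpha k)).-1.

Lemma cf_deg0 alpha : cf_deg alpha 0 = 0%N.
Proof. by rewrite /cf_deg /cf_den /= size_poly1. Qed.

(** This is [cf_invariant] at k + 1, where the older entry of the pair is Q_k; hence the exponent
    deg Q_{k+1}. *)
Lemma cf_approx alpha k : lirrational alpha -> exists P,
  let D := of_poly (cf_den alpha k) * alpha - of_poly P in
  [/\ D != 0, ldeg D = - (cf_deg alpha k.+1)%:Z & (cf_deg alpha k < cf_deg alpha k.+1)%N].
Proof.
move=> irr; have := cf_invariant k.+1 irr; have := cf_den_neq0 k irr.
rewrite /cf_deg /cf_den /=; case: cf_den2 => Q' Q /=.
rewrite -size_poly_gt0 => Q0 [P' [P [sQ D0 dD _ _]]]; exists P'; split=> //.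
by rewrite -ltnS !prednK// (ltn_trans Q0).
Qed.

(** Degrees rise by at least one per step, so c further convergents make room for a hole c digits
    deep. *)
Lemma cf_deg_mono alpha j m : lirrational alpha ->
  (cf_deg alpha j + m <= cf_deg alpha (j + m))%N.
Proof.
move=> irr; elim: m => [|m IH]; first by rewrite !addn0.
have [_ [_ _]] := cf_approx (j + m) irr; rewrite !addnS; exact: leq_ltn_trans.
Qed.

(* Ostrowski expansion of theta, truncated after k digits: the next digit b is the
   polynomial part of the remaining error divided by Q_k alpha - P_k. *)
Lemma inhomogeneous_approx alpha k theta : lirrational alpha -> bnd theta (-1) ->
  exists Q P : {poly F}, (size Q <= cf_deg alpha k)%N /\
    bnd (of_poly Q * alpha - of_poly P - theta) (- (cf_deg alpha k)%:Z - 1).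
Proof.
move=> irr tb; elim: k => [|k [Q [P [sQ eb]]]].
  exists 0, 0; rewrite size_poly0 of_poly0 mul0r subrr sub0r cf_deg0; split=> //.
  exact: bndN.
have [P' [D0 dD dlt]] := cf_approx k irr.
set D := of_poly _ * _ - _ in D0 dD.
set e := of_poly Q * _ - _ - _ in eb.
set b := poly_part (e / D).
have Vb : bnd (D^-1)%R (cf_deg alpha k.+1).
  by have := @ldeg_bnd (D^-1)%R; rewrite ldegV// dD opprK.
(* The degree of [e / D] is at most d_{k+1} - d_k - 1, so subtracting b Q_k keeps deg Q below
   d_{k+1}. *)
have sb : (size b <= cf_deg alpha k.+1 - cf_deg alpha k)%N.
  by apply: size_poly_part; apply: (@bndW (e / D)%R _ _ (bndM eb Vb)); move: dlt; lia.
exists (Q - b * cf_den alpha k), (P - b * P'); split.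
  rewrite (leq_trans (size_polyD _ _))// geq_max (leq_trans sQ (ltnW dlt)) size_polyN/=.
  by rewrite (leq_trans (size_polyMleq _ _))//; move: sb dlt; rewrite /cf_deg; lia.
rewrite !of_polyD !of_polyN !of_polyM.
(* The new error is D times the fractional part of [e / D], hence of degree below deg D =
   -d_{k+1}. *)
have -> : (of_poly Q - of_poly b * of_poly (cf_den alpha k)) * alpha -
    (of_poly P - of_poly b * of_poly P') - theta = D * (e / D - of_poly b).
  by rewrite mulrBr mulrCA divff// mulr1 /e /D; ring.
by rewrite -dD; apply: bndM; [exact: ldeg_bnd|exact: frac_bnd].
Qed.

(* Adding Q_k to the Q of inhomogeneous_approx forces the degree and does not spoil
   the approximation. *)
Lemma exact_deg_approx alpha k theta : lirrational alpha -> bnd theta (-1) ->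
  exists Q P : {poly F}, size Q = (cf_deg alpha k).+1 /\
    bnd (of_poly Q * alpha - of_poly P - theta) (- (cf_deg alpha k)%:Z - 1).
Proof.
move=> irr /(inhomogeneous_approx k irr)[Q [P [sQ eb]]].
have [P' [D0 dD dlt]] := cf_approx k irr.
have sk : size (cf_den alpha k) = (cf_deg alpha k).+1.
  by rewrite prednK// size_poly_gt0 cf_den_neq0.
exists (cf_den alpha k + Q), (P' + P); split; first by rewrite size_polyDl sk.
rewrite !of_polyD; have -> : forall a b c d e : laurent F,
    (a + b) * c - (d + e) - theta = (a * c - d) + (b * c - e - theta).
  by move=> *; ring.
apply: bndD => //; set D := (_ - _ : laurent F) in D0 dD *.
apply: (@bndW D (ldeg D)); first exact: ldeg_bnd.
by rewrite dD; move: dlt; lia.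
Qed.

End Laurent.

(** * Null sets of Hausdorff measures *)

Section Hausdorff.
Context {R : realType} {T : Type} (d : T -> T -> R).
Local Open Scope ereal_scope.

Lemma diam_pow_ge0 (s : R) (A : set T) : 0 <= diam_pow d s A.
Proof. by rewrite /diam_pow; case: ifP => // _; exact: poweR_ge0. Qed.

Lemma hausdorff_premeasure_ge0 (s delta : R) (A : set T) :
  0 <= hausdorff_premeasure d s delta A.
Proof.
apply: le_ereal_inf_tmp => _ [U _ <-]; apply: nneseries_ge0 => i _ _.
exact: diam_pow_ge0.
Qed.

(** Countable subadditivity for null sets: cover the n-th piece at cost e / 2^(n+1) and enumerate
    all the covers along a bijection of nat with its square. *)
Lemma hausdorff_measure_eq0 (s : R) (A : set T) (B : (set T)^nat) :
  A `<=` \bigcup_n B n ->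
  (forall (n : nat) (delta e : R), (0 < delta)%R -> (0 < e)%R ->
    exists U : (set T)^nat, [/\ B n `<=` \bigcup_i U i,
      forall i, diam d (U i) <= delta%:E &
      \sum_(0 <= i <oo) diam_pow d s (U i) <= e%:E]) ->
  hausdorff_measure d s A = 0.
Proof.
move=> AB BU.
suff pre0 (delta : R) : (0 < delta)%R -> hausdorff_premeasure d s delta A = 0.
  apply/eqP; rewrite eq_le; apply/andP; split.
    by apply: ub_ereal_sup => _ [delta /= delta0 <-]; rewrite pre0.
  by apply: ereal_sup_ubound; exists 1%R => //=; rewrite pre0.
move=> delta0; apply/eqP; rewrite eq_le hausdorff_premeasure_ge0 andbT.
apply/lee_addgt0Pr => e e0; rewrite add0e.
have e2 n : (0 < e / (2 ^ n.+1)%:R)%R by rewrite divr_gt0// ltr0n expn_gt0.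
have [G GE] := choice (fun n => BU n delta _ delta0 (e2 n)).
have dp0 n j : 0 <= diam_pow d s (G n j) by exact: diam_pow_ge0.
have /card_esym/ppcard_eqP[f] := card_nat2.
pose V k := G (f k).1 (f k).2.
have VA : A `<=` \bigcup_k V k.
  move=> t /AB[n _ Bnt]; have [/(_ t Bnt)[j _ ?] _ _] := GE n.
  by exists (f^-1%FUN (n, j)) => //; rewrite /V invK ?inE.
have Vdelta k : diam d (V k) <= delta%:E by have [_ + _] := GE (f k).1; exact.
apply: le_trans (ereal_inf_lbound _) _; first by exists V; first split.
have -> : \sum_(k <oo) diam_pow d s (V k) =
    \sum_(n <oo) \sum_(j <oo) diam_pow d s (G n j).
  rewrite nneseries_esumT; last by move=> *; exact: diam_pow_ge0.
  rewrite nneseries_esumT; last first.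
    by move=> n; apply: nneseries_ge0 => *; exact: diam_pow_ge0.
  under [RHS]eq_esum do rewrite nneseries_esumT//.
  rewrite esum_esum//.
  have -> : [set: nat] `*`` (fun=> [set: nat]) = setT by apply/seteqP.
  by rewrite (reindex_esum setT _ f).
apply: (@le_trans _ _ (\sum_(i <oo) (0 + (e / (2 ^ i.+1)%:R)%:E))).
  apply: lee_nneseries => i _.
    by move=> _; apply: nneseries_ge0 => *; exact: diam_pow_ge0.
  by rewrite add0e; case: (GE i).
apply: le_trans (epsilon_trick _ _ (ltW e0)) _ => //.
by rewrite eseries0// add0e.
Qed.

(** The list is continued by empty sets, which cost nothing even for s = 0 by the convention in
    [diam_pow]. *)
Lemma finite_cover (s r : R) (A : set T) (l : seq (set T)) :
  (0 <= s)%R -> (forall x y, 0 <= d x y)%R ->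
  A `<=` \bigcup_(i in [set i | (i < size l)%N]) nth set0 l i ->
  (forall i, diam d (nth set0 l i) <= r%:E) ->
  \sum_(0 <= i <oo) diam_pow d s (nth set0 l i) <= ((size l)%:R * r `^ s)%:E.
Proof.
move=> s0 d0 Al lr.
rewrite (nneseries_split 0 (size l)); last by move=> *; exact: diam_pow_ge0.
rewrite [X in _ + X]eseries0 ?adde0; last first.
  move=> i; rewrite add0n => li _.
  by rewrite /diam_pow nth_default// ifT//; exact/asboolP.
rewrite add0n; have term i : diam_pow d s (nth set0 l i) <= (r `^ s)%:E.
  (* The diameter of an empty set is -oo, so monotonicity of the power is applied to nonempty sets
     only. *)
  rewrite /diam_pow; case: ifPn => [_|/asboolP/eqP/set0P[x xi]].
    by rewrite lee_fin powR_ge0.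
  have diam0 : 0 <= diam d (nth set0 l i).
    apply: le_trans (ereal_sup_ubound _); last by exists x => //; exists x.
    by rewrite lee_fin.
  have r0 : 0 <= r%:E := le_trans diam0 (lr i).
  by rewrite -poweR_EFin; apply: gt0_ler_poweR => //; rewrite in_itv/= leey andbT.
apply: (@le_trans _ _ (\sum_(0 <= i < size l) (r `^ s)%:E)).
  by apply: lee_sum.
by rewrite sumEFin lee_fin big_const_nat subn0 iter_addr_0 mulr_natl.
Qed.

End Hausdorff.

(** Choose a real C above the liminf; if u stayed at or above C from K on, the infimum of that tail
    would already push the liminf up to C. *)
Lemma limn_einf_frequently (R : realType) (u : nat -> R) :
  (limn_einf (fun k => (u k)%:E) < +oo)%E ->
  exists C, 0 < C /\ forall K, exists k, (K <= k)%N /\ u k < C.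
Proof.
move=> uoo.
have [C [C0 uC]] : exists C, 0 < C /\ (limn_einf (fun k => (u k)%:E) < C%:E)%E.
  (* The absolute value keeps C positive; a liminf of -oo lies below C = 1. *)
  move: uoo; case: limn_einf => [r _|//|_]; last by exists 1; rewrite ltNyr.
  exists (`|r| + 1); split; first by rewrite ltr_wpDl.
  by rewrite lte_fin (le_lt_trans (ler_norm r))// ltrDl.
exists C; split=> // K; apply: contrapT => h; move: uC.
apply/negP; rewrite -leNgt limn_einf_lim (cvg_lim _ (@cvg_einfs_sup _ _))//.
apply: le_trans (ereal_sup_ubound _); last by exists K.
apply: le_ereal_inf_tmp => _ [k /= Kk <-]; rewrite lee_fin leNgt.
by apply/negP => ukC; apply: h; exists k.
Qed.

(** * Counting balls that meet a set of badly approximable points *)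

Section Prefix.
Context {F : fieldType}.
Implicit Types x y : laurent F.

Definition lprefix (n : nat) x : seq F := mkseq (fun i => x (- i.+1%:Z)) n.

Lemma lprefixD (n m : nat) x :
  lprefix (n + m) x = lprefix n x ++ mkseq (fun i => x (- (n + i).+1%:Z)) m.
Proof.
rewrite /lprefix /mkseq iotaD map_cat add0n.
by rewrite -[in iota n m](addn0 n) iotaDl -map_comp.
Qed.

(** In the unit ball all coefficients of nonnegative index vanish, so n digits fix a point up to
    terms of degree at most -n - 1. *)
Lemma lprefix_eqP (n : nat) x y : bnd x (-1) -> bnd y (-1) ->
  lprefix n x = lprefix n y <-> bnd (x - y) (- n%:Z - 1).
Proof.
move=> xb yb; split=> [xy i ni|xy]; last first.
  apply/eq_in_map => i; rewrite mem_iota add0n => /= ni.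
  by apply/eqP; rewrite -subr_eq0; apply/eqP; apply: xy; lia.
have [ilt|ige] := leP 0 i; first by apply: (bndB xb yb); lia.
have [k ik] : exists k : nat, i = - k.+1%:Z by exists `|i|.-1; lia.
have kn : (k < n)%N by lia.
have := congr1 (fun s => nth 0 s k) xy; rewrite !nth_mkseq// -ik => xyi.
by apply/eqP; rewrite subr_eq0; apply/eqP.
Qed.

End Prefix.

Section Norm.
Context {R : realType} {F : finFieldType}.
Implicit Types (x : laurent F) (Q : {poly F}).
Local Notation q := (#|F|%:R : R).

Lemma natr_card_gt1 : 1 < q.
Proof. by rewrite ltr1n; exact: card_finNzRing_gt1. Qed.

Lemma natr_card_gt0 : 0 < q.
Proof. exact: lt_trans ltr01 natr_card_gt1. Qed.

Lemma lnorm_le x (N : int) : bnd x N -> lnorm R x <= q ^ N.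
Proof.
move=> xN; rewrite /lnorm; case: eqVneq => [_|/ldegP[xd _]].
  by rewrite exprz_ge0// ltW// natr_card_gt0.
rewrite ler_weXz2l//; first exact/ltW/natr_card_gt1.
by rewrite leNgt; apply/negP => /xN /eqP; exact/negP.
Qed.

Lemma lnorm_lt1 x : lnorm R x < 1 -> bnd x (-1).
Proof.
rewrite /lnorm; case: eqVneq => [->//|x0] xlt n n1.
apply: (@ldeg_bnd _ x); apply: le_lt_trans n1.
have : ~~ (0 <= ldeg x); last by lia.
apply/negP => d0; move: xlt; apply/negP; rewrite -leNgt.
by rewrite -[1](expr0z q) ler_weXz2l//; exact/ltW/natr_card_gt1.
Qed.

Lemma lnorm_of_poly Q (n : nat) : size Q = n.+1 -> lnorm R (of_poly Q) = q ^+ n.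
Proof.
move=> sQ; have Q0 : Q != 0 by rewrite -size_poly_gt0 sQ.
by rewrite /lnorm of_poly_eq0 (negPf Q0) ldeg_of_poly// sQ.
Qed.

End Norm.

Section Covering.
Context {R : realType} {F : finFieldType}.
Implicit Types (B : set (laurent F)) (delta : R).
Local Notation q := (#|F|%:R : R).

(* A prefix of length n stands for one of the q^n balls of radius q^-n that partition
   the unit ball; delta is the proportion of them needed to cover B. *)
Definition covered B (n : nat) delta := exists s : seq (seq F),
  (size s)%:R <= delta * q ^+ n /\ forall x, B x -> lprefix n x \in s.

Definition words (n : nat) : seq (seq F) := [seq val w | w <- enum {: n.-tuple F}].

Lemma size_words n : size (words n) = (#|F| ^ n)%N.
Proof. by rewrite size_map -cardE card_tuple. Qed.

Lemma mem_words n (w : seq F) : size w = n -> w \in words n.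
Proof.
by move=> /eqP wn; apply/mapP; exists (Tuple wn); rewrite ?mem_enum.
Qed.

Lemma covered1 B n : covered B n 1.
Proof.
exists (words n); rewrite size_words natrX mul1r; split=> // x _.
by rewrite mem_words// size_mkseq.
Qed.

Lemma coveredD B n m delta : covered B n delta -> covered B (n + m) delta.
Proof.
move=> [s [ss Bs]]; exists [seq v ++ w | v <- s, w <- words m]; split.
  rewrite size_allpairs size_words natrM natrX exprD mulrA.
  by rewrite ler_wpM2r// exprn_ge0.
move=> x /Bs xs; rewrite lprefixD; apply/allpairsP; eexists (_, _).
by split=> /=; [exact: xs| |reflexivity]; rewrite mem_words// size_mkseq.
Qed.

(** Each prefix has q^c extensions by c digits. The hole discards one of them, and q^c - 1 = (1 -
    q^-c) q^c. *)
Lemma covered_hole B n c delta :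
  (forall x0, B x0 -> exists w, size w = c /\
    forall x, B x -> lprefix (n + c) x <> lprefix n x0 ++ w) ->
  covered B n delta -> covered B (n + c) ((1 - q ^- c) * delta).
Proof.
move=> hole [s [ss Bs]].
have /choice[u uP] : forall v, exists w, size w = c /\
    forall x, B x -> lprefix n x = v -> lprefix (n + c) x <> v ++ w.
  move=> v; have [[x0 [Bx0 <-]]|nv] := pselect (exists x0, B x0 /\ lprefix n x0 = v).
    by have [w [wc h]] := hole _ Bx0; exists w; split=> // x Bx _; exact: h.
  (* No point of B has prefix v, so any word of length c may be discarded. *)
  by exists (nseq c 0); rewrite size_nseq; split=> // x Bx xv; case: nv; exists x.
exists [seq v ++ w | v <- s, w <- rem (u v) (words c)]; split.
  rewrite size_allpairs_dep.
  under eq_map => v do rewrite size_rem ?size_words ?mem_words ?(uP v).1//.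
  have -> (k : nat) : sumn [seq k | _ <- s] = (size s * k)%N.
    by elim: s {ss Bs} => //= _ s ->; rewrite mulSn.
  have qc0 : (0 < #|F| ^ c)%N by rewrite expn_gt0 (ltnW (card_finNzRing_gt1 F)).
  rewrite natrM -subn1 natrB// natrX exprD.
  have qc : q ^+ c != 0 by rewrite expf_neq0// gt_eqF// natr_card_gt0.
  have -> : (1 - q ^- c) * delta * (q ^+ n * q ^+ c) = delta * q ^+ n * (q ^+ c - 1).
    by field.
  by rewrite ler_wpM2r// subr_ge0 exprn_ege1// ltW// natr_card_gt1.
move=> x Bx; have := (uP (lprefix n x)).2 x Bx erefl; rewrite lprefixD.
set w := mkseq _ _ => wne; apply/allpairsPdep; exists (lprefix n x), w.
split=> //; first exact: Bs.
apply: rem_mem; last by rewrite mem_words// size_mkseq.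
by apply/eqP => wu; apply: wne; rewrite wu.
Qed.


(** * Holes at the scales of the convergents *)

Section BadUniform.
Context (alpha : laurent F) (alpha_irr : lirrational alpha) (eps M : R).
Local Notation d := (cf_deg alpha).

(** Fixing the threshold M, which the liminf lets depend on theta, makes the same scales usable for
    all points at once. *)
Definition Bad_uniform : set (laurent F) := [set theta : laurent F | bnd theta (-1) /\
  forall Q, M <= lnorm R (of_poly Q) ->
    eps <= lnorm R (of_poly Q) * dist_poly R (of_poly Q * alpha - theta)].

Context (c : nat) (c_eps : q ^- c < eps).

(* The hole is the ball of radius q^-(d k + c) around Q alpha mod F[z], for the Q of
   exact_deg_approx. *)
Lemma Bad_uniform_hole k theta0 : M <= q ^+ d k -> Bad_uniform theta0 ->
  exists w, size w = c /\ forall theta, Bad_uniform theta ->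
    lprefix (d k + c) theta <> lprefix (d k) theta0 ++ w.
Proof.
move=> Mk [tb0 _]; have [Q [P [sQ yb]]] := exact_deg_approx k alpha_irr tb0.
set y : laurent F := of_poly Q * alpha - of_poly P in yb.
have yb1 : bnd y (-1).
  rewrite -(subrK theta0 y); apply: bndD tb0.
  by apply: (@bndW _ (y - theta0)); first exact: yb; lia.
exists (mkseq (fun i => y (- (d k + i).+1%:Z)) c); split; first by rewrite size_mkseq.
move=> theta [tb bad].
have <- : lprefix (d k) y = lprefix (d k) theta0 by apply/lprefix_eqP.
(* A theta in the hole would agree with y to d_k + c digits, giving a product of at most q^(d_k)
   q^-(d_k + c) = q^-c < eps. *)
rewrite -lprefixD => /esym /lprefix_eqP -/(_ yb1 tb) ytb.
have nQ := lnorm_of_poly (R := R) sQ.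
have := bad Q; rewrite nQ => /(_ Mk); apply/negP; rewrite -ltNge.
apply: le_lt_trans c_eps; apply: (@le_trans _ _ (q ^+ d k * q ^ (- (d k + c)%N%:Z))).
  rewrite ler_wpM2l//.
  rewrite dist_polyE; apply: le_trans (poly_part_nearest _ _ P) _.
  apply: lnorm_le; rewrite addrAC.
  by apply: (@bndW _ (y - theta)); first exact: ytb; lia.
have q0 : q != 0 by rewrite gt_eqF// natr_card_gt0.
by rewrite exprnP -expfzDr// PoszD opprD addNKr exprnN.
Qed.

(** Each block of c indices gains at least c digits: the first c carry a hole, and the remaining
    ones only refine the cover. *)
Lemma Bad_uniform_covered j i : M <= q ^+ d j ->
  covered Bad_uniform (d (j + c * i)) ((1 - q ^- c) ^+ i).
Proof.
move=> Mj; elim: i => [|i IH]; first exact: covered1.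
have Mji : M <= q ^+ d (j + c * i).
  apply: le_trans Mj _; rewrite ler_weXn2l ?(ltW natr_card_gt1)//.
  by apply: leq_trans (cf_deg_mono j (c * i) alpha_irr); rewrite leq_addr.
have h := cf_deg_mono (j + c * i) c alpha_irr.
rewrite mulnS [(c + _)%N]addnC addnA exprS -(subnK h) addnC.
by apply/coveredD/covered_hole => // x0; exact: Bad_uniform_hole.
Qed.

End BadUniform.

(** A liminf of at least eps bounds the products eventually only by a smaller eps'. Rounding the
    threshold up to an integer makes the union countable. *)
Lemma Bad_sub_uniform eps eps' alpha : eps' < eps ->
  Bad eps alpha `<=` \bigcup_m Bad_uniform alpha eps' m%:R.
Proof.
move=> ee theta [/= /lnorm_lt1 tb] bad.
have /ereal_sup_gt[_ [M _ <-] inf] : (eps'%:E < poly_liminf (fun Q =>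
    (lnorm R (of_poly Q) * dist_poly R (of_poly Q * alpha - theta))%:E))%E.
  by apply: lt_le_trans bad; rewrite lte_fin.
exists (Num.truncn `|M|).+1 => //; split=> // Q MQ.
rewrite -lee_fin (le_trans (ltW inf))//; apply: ereal_inf_lbound; exists Q => //=.
apply: le_trans MQ; rewrite (le_trans (ler_norm M))// ltW//.
by rewrite truncnS_gt.
Qed.

End Covering.

(** * The dimension bound *)

Section Dimension.
Context {R : realType} {F : finFieldType}.
Local Notation q := (#|F|%:R : R).

Lemma covered_hausdorff (B : set (laurent F)) n (delta s : R) : 0 <= s ->
  (forall x, B x -> bnd x (-1)) -> covered B n delta ->
  exists U : (set (laurent F))^nat, [/\ B `<=` \bigcup_i U i,
    forall i, (diam (@ldist R F) (U i) <= (q ^- n)%:E)%E &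
    (\sum_(0 <= i <oo) diam_pow (@ldist R F) s (U i) <=
       (delta * q ^+ n * (q ^- n) `^ s)%:E)%E].
Proof.
move=> s0 Bb [l [sl Bl]].
pose ball w := [set x : laurent F | bnd x (-1) /\ lprefix n x = w].
have diamU i : (diam (@ldist R F) (nth set0 (map ball l) i) <= (q ^- n)%:E)%E.
  apply: ge_ereal_sup => _ [x + [y + <-]].
  have [il|li] := ltnP i (size l); last by rewrite nth_default ?size_map.
  rewrite (nth_map [::])// => -[xb xw] [yb yw]; rewrite lee_fin.
  have xyb : bnd (x - y) (- n%:Z - 1) by apply/lprefix_eqP; rewrite ?xw ?yw.
  rewrite exprnN; apply: lnorm_le.
  by apply: (@bndW _ (x - y)); first exact: xyb; lia.
have Bcov : B `<=`
    \bigcup_(i in [set i | (i < size (map ball l))%N]) nth set0 (map ball l) i.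
  move=> x Bx; have xl := Bl _ Bx; exists (index (lprefix n x) l).
    by rewrite /= size_map index_mem.
  by rewrite (nth_map [::]) ?index_mem// nth_index//; split=> //; exact: Bb.
exists (nth set0 (map ball l)); split=> //.
  by move=> x /Bcov[i _ xi]; exists i.
apply: le_trans (finite_cover s0 _ Bcov diamU) _; first by move=> x y; exact: lnorm_ge0.
by rewrite size_map lee_fin ler_wpM2r// powR_ge0.
Qed.

Lemma card_expR (n : nat) : q ^+ n = expR (n%:R * ln q).
Proof. by rewrite expRM_natl lnK// posrE natr_card_gt0. Qed.

Lemma ltr_card_exp (n : nat) : n%:R < q ^+ n.
Proof. by rewrite -natrX ltr_nat ltn_expl// card_finNzRing_gt1. Qed.

Lemma archimedean_exp_lt (r : R) : 0 < r -> exists2 c : nat, (0 < c)%N & q ^- c < r.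
Proof.
move=> r0; exists (Num.truncn r^-1).+1 => //.
rewrite -[ltRHS]invrK ltf_pV2 ?posrE ?invr_gt0 ?exprn_gt0 ?natr_card_gt0//.
exact: lt_trans (truncnS_gt _) (ltr_card_exp _).
Qed.

(* With lam = 1 - q^-c and k = m + c i + O(1), covering at scale q^-d_k gives a
   Hausdorff sum of at most lam^i q^(tau d_k) <= exp (i ln lam + tau C k), which
   decays along the k of the growth hypothesis when tau C c < - ln lam. *)
Lemma Bad_uniform_small_cover alpha eps (m c : nat) (C tau delta e : R) :
  lirrational alpha -> (0 < c)%N -> q ^- c < eps ->
  (forall K, exists k, (K <= k)%N /\ (cf_deg alpha k)%:R * ln q <= C * k%:R) ->
  0 < C -> 0 < tau <= 1 -> tau * C * c%:R <= - ln (1 - q ^- c) / 2 ->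
  0 < delta -> 0 < e ->
  exists U : (set (laurent F))^nat,
    [/\ Bad_uniform alpha eps m%:R `<=` \bigcup_i U i,
      forall i, (diam (@ldist R F) (U i) <= delta%:E)%E &
      (\sum_(0 <= i <oo) diam_pow (@ldist R F) (1 - tau) (U i) <= e%:E)%E].
Proof.
move=> irr c0 ceps growth C0 /andP[tau0 tau1] tauC delta0 e0.
set lam := 1 - q ^- c in tauC *; set L := - ln lam in tauC *.
have lam0 : 0 < lam.
  rewrite subr_gt0 invf_lt1 ?exprn_gt0 ?natr_card_gt0//.
  by rewrite exprn_egt1 ?natr_card_gt1// -lt0n.
have L0 : 0 < L.
  by rewrite oppr_gt0 ln_lt0// lam0 gtrBl invr_gt0 exprn_gt0// natr_card_gt0.
(* Since k < m + c + c i, K is the part of the bound on tau C k that does not grow with i. *)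
pose K := tau * C * (m + c)%:R.
(* The first summand makes L i / 2 exceed K - ln e, the second makes q^-n at most delta. *)
pose I := (Num.truncn `|(K - ln e) * 2 / L| + Num.truncn delta^-1).+1.
have [k [Ik dk]] := growth (m + c * I)%N.
set n := cf_deg alpha k in dk.
pose i := ((k - m) %/ c)%N.
have kE : k = (m + c * i + (k - m) %% c)%N.
  by have := divn_eq (k - m) c; rewrite -/i; lia.
have Ii : (I <= i)%N by rewrite leq_divRL//; lia.
have nk : (k <= n)%N by have := cf_deg_mono 0 k irr; rewrite cf_deg0.
have cov : covered (Bad_uniform alpha eps m%:R) n (lam ^+ i).
  (* The threshold m is passed at index m, because m < q^m and d_m >= m. *)
  have mm : (m%:R : R) <= q ^+ cf_deg alpha m.
    apply: le_trans (ltW (ltr_card_exp m)) _.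
    rewrite ler_weXn2l ?(ltW natr_card_gt1)//.
    by have := cf_deg_mono 0 m irr; rewrite cf_deg0.
  have := Bad_uniform_covered irr ceps i mm.
  (* The last (k - m) mod c indices produce no hole; the cover is merely refined there. *)
  have h : (cf_deg alpha (m + c * i) <= n)%N.
    by rewrite /n {1}kE (leq_trans _ (cf_deg_mono _ _ irr))// leq_addr.
  by rewrite -(subnKC h); exact: coveredD.
have [||U [BU dU sU]] := covered_hausdorff (s := 1 - tau) _ _ cov.
- by rewrite subr_ge0.
- by move=> x [].
exists U; split=> // [t|]; first (apply: le_trans (dU t) _).
  rewrite lee_fin -[leRHS]invrK lef_pV2 ?posrE ?invr_gt0 ?exprn_gt0 ?natr_card_gt0//.
  apply/ltW/(lt_trans (truncnS_gt _))/le_lt_trans/ltr_card_exp.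
  rewrite ler_nat; apply: leq_trans nk; apply: leq_trans Ik.
  apply: leq_trans (leq_addl _ _); apply: leq_trans (leq_pmull _ c0).
  by rewrite ltnS leq_addl.
apply: le_trans sU _; rewrite lee_fin.
have -> : lam ^+ i * q ^+ n * (q ^- n) `^ (1 - tau) =
    expR (- L * i%:R + tau * (n%:R * ln q)).
  rewrite card_expR -expRN.
  rewrite -[lam]lnK ?posrE// -expRM_natl /powR gt_eqF ?expR_gt0// expRK -!expRD.
  by congr expR; rewrite /L; ring.
rewrite -[leRHS]lnK ?posrE// ler_expR.
have iI : (K - ln e) * 2 / L <= i%:R.
  apply: le_trans (ler_norm _) _; apply/ltW/(lt_le_trans (truncnS_gt _)).
  by rewrite ler_nat; apply: leq_trans Ii; rewrite ltnS leq_addr.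
have Klin : K - ln e <= L / 2 * i%:R.
  by move: iI; rewrite ler_pdivrMr//; lra.
have kci : (k%:R : R) <= (m + c)%:R + c%:R * i%:R.
  rewrite -natrM -natrD ler_nat {1}kE.
  by have := ltn_pmod (k - m) c0; lia.
have h1 : tau * (n%:R * ln q) <= tau * C * k%:R.
  by rewrite -mulrA ler_wpM2l// ltW.
have h2 : tau * C * k%:R <= K + tau * C * c%:R * i%:R.
  rewrite /K -[tau * C * c%:R * _]mulrA -mulrDr ler_wpM2l//.
  by rewrite mulr_ge0// ltW.
have h3 : tau * C * c%:R * i%:R <= L / 2 * i%:R by rewrite ler_wpM2r.
(* One half of L i absorbs tau C c i, the other half absorbs K - ln e. *)
by lra.
Qed.

End Dimension.

Theorem theorem9p1 (R : realType) (F : finFieldType) (alpha : laurent F)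
  (alpha_irr : lirrational alpha)
  (growth : (limn_einf (fun k : nat =>
     (ln (lnorm R (of_poly (cf_den alpha k))) / k%:R)%:E) < +oo)%E)
  (eps : R) (eps_gt0 : 0 < eps) :
  (hausdorff_dim (@ldist R F) (Bad eps alpha) < 1)%E.
Proof.
have [C [C0 freq]] := limn_einf_frequently growth.
have freqC K : exists k, (K <= k)%N /\
    (cf_deg alpha k)%:R * ln (#|F|%:R : R) <= C * k%:R.
  (* Asking for index K + 1 makes k positive, so the division by k can be cleared. *)
  have [k [Kk]] := freq K.+1; exists k; split; first exact: ltnW.
  have k0 : 0 < k%:R :> R by rewrite ltr0n (leq_trans _ Kk).
  have sk : size (cf_den alpha k) = (cf_deg alpha k).+1.
    by rewrite prednK// size_poly_gt0 cf_den_neq0.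
  move: b; rewrite ltr_pdivrMr// (lnorm_of_poly sk) card_expR expRK.
  exact: ltW.
(* The hole depth is fitted to eps / 2, leaving the slack that [Bad_sub_uniform] requires. *)
have [c c0 ceps] := @archimedean_exp_lt R F _ (divr_gt0 eps_gt0 (ltr0Sn R 1)).
set L := - ln (1 - (#|F|%:R : R) ^- c).
have L0 : 0 < L.
  rewrite oppr_gt0 ln_lt0// gtrBl invr_gt0 exprn_gt0 ?natr_card_gt0// andbT subr_gt0.
  by rewrite invf_lt1 ?exprn_gt0 ?natr_card_gt0// exprn_egt1 ?natr_card_gt1// -lt0n.
have Cc0 : 0 < 2 * C * c%:R by rewrite !mulr_gt0// ltr0n.
(* The bound 1 keeps the exponent 1 - tau nonnegative; the other bound gives tau C c <= L / 2. *)
pose tau := Num.min 1 (L / (2 * C * c%:R)).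
have tau0 : 0 < tau by rewrite lt_min ltr01 divr_gt0.
have tau1 : tau <= 1 by rewrite ge_min lexx.
have tauC : tau * C * c%:R <= L / 2.
  have : tau <= L / (2 * C * c%:R) by rewrite ge_min lexx orbT.
  by rewrite ler_pdivlMr//; lra.
apply: (@le_lt_trans _ _ (1 - tau)%:E); last by rewrite lte_fin gtrBl.
apply: ereal_inf_lbound; exists (1 - tau) => //; split; first by rewrite subr_ge0.
have eps2 : eps / 2 < eps by lra.
apply: (hausdorff_measure_eq0 (Bad_sub_uniform (alpha := alpha) eps2)).
move=> m delta e delta0 e0.
apply: (@Bad_uniform_small_cover _ _ alpha (eps / 2) m c C tau) => //.
by rewrite tau0.
Qed.
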